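(* Consider an ego vehicle with a rectangular footprint of length $l_e$ and width $w_e$ ($l_e\ge w_e>0$) and an object vehicle with a rectangular footprint of length $l_o$ and width $w_o$ ($l_o\ge w_o>0$). Let the two footprints be covered by $N_{c,e}\ge 1$ and $N_{c,o}\ge 1$ circles, respectively, with radii and centers placed as specified in the context. Let the object's configuration $\mathbf{y}_o=(x_o,y_o,\theta_o)$ be a random vector with values in $\mathbb{R}^2\times\mathbb{R}_{\ge 0}$, with probability density $p_{\mathbf{y}_o}$ and mutually independent components, so that $p_{\mathbf{y}_o}(x,y,\theta)=p_{x_o}(x)\,p_{y_o}(y)\,p_{\theta_o}(\theta)$. Let $\mathbf{y}_{o,p}=(\phi_o,\rho_o,\theta_o)$ be its polar representation. With the sets $\tilde{\mathcal{A}}_{rec}$, $\tilde{\mathcal{A}}_{\theta_o}(\phi,\rho)$, $\tilde{\mathcal{A}}_{cir}$ and the constant $\overline{\rho}$ defined in the context, the probability of collision $$\mathrm{POC}=\mathbb{P}\{\mathbf{y}_o\in\tilde{\mathcal{A}}_{rec}\}=\int_{\tilde{\mathcal{A}}_{rec}}p_{\mathbf{y}_o}(\mathbf{y})\,d\mathbf{y}$$ is over-approximated by the multi-circle estimate, i.e. $$\mathbb{P}\{\mathbf{y}_o\in\tilde{\mathcal{A}}_{rec}\}\;\le\;\mathbb{P}\{\mathbf{y}_{o,p}\in\tilde{\mathcal{A}}_{cir}\}=\int_0^{2\pi}\int_0^{\overline{\rho}}p_{\phi_o,\rho_o}(\phi,\rho)\left[\int_{\tilde{\mathcal{A}}_{\theta_o}(\phi,\rho)}p_{\theta_o}(\theta)\,d\theta\right]d\rho\,d\phi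 .$$
   Context: **Frame and footprints.** All quantities are expressed in the ego's frame: the ego's geometric center is the origin and its longitudinal axis is the $x$-axis. For a configuration $\mathbf{y}=(x,y,\theta)\in\mathcal{C}:=\mathbb{R}^2\times\mathbb{R}_{\ge0}$ and a vehicle of length $l$ and width $w$, the footprint is the closed rectangle centered at $(x,y)$ whose side of length $l$ is parallel to $(\cos\theta,\sin\theta)$ and whose side of length $w$ is perpendicular to it. $\mathcal{S}_e$ denotes the ego's footprint (configuration $(0,0,0)$, dimensions $l_e,w_e$) and $\mathcal{S}_o(\mathbf{y})$ the object's footprint at configuration $\mathbf{y}$ (dimensions $l_o,w_o$). The set of colliding object configurations is $$\tilde{\mathcal{A}}_{rec}:=\{\mathbf{y}\in\mathcal{C}\mid \mathcal{S}_e\cap\mathcal{S}_o(\mathbf{y})\neq\emptyset\}.$$ **Circle covering.** A rectangle of length $l$ and width $w$ is covered by $N_c$ closed disks of common radius $r=\sqrt{(l/(2N_c))^2+w^2/4}$. Their centers lie on the rectangle's central longitudinal axis, symmetric about its center, with equal spacing $d_c=2\sqrt{r^2-w^2/4}$ (which equals $l/N_c$). That is, the $i$-th center has signed offset $\left(i-\tfrac{N_c+1}{2}\right)d_c$ from the geometric center in the heading direction, $i=1,\dots,N_c$. Write $r_e,d_{c,e}$ and $r_o,d_{c,o}$ for these quantities for the ego (with $N_{c,e}$ circles) and the object (with $N_{c,o}$ circles). Put $R:=r_e+r_o$ and $$\overline{\rho}:=R+\tfrac{d_{c,o}}{2}(N_{c,o}-1)+\tfrac{d_{c,e}}{2}(N_{c,e}-1).$$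 **Polar coordinates.** $\rho_o=\sqrt{x_o^2+y_o^2}$ and $\phi_o=\mathrm{atan2}(y_o,x_o)$ taken in $[0,2\pi)$, so $(x_o,y_o)=(\rho_o\cos\phi_o,\rho_o\sin\phi_o)$. The joint density of $(\phi_o,\rho_o)$ is $p_{\phi_o,\rho_o}(\phi,\rho)=\rho\,p_{x_o}(\rho\cos\phi)\,p_{y_o}(\rho\sin\phi)$ for $\phi\in[0,2\pi)$, $\rho\ge0$. The polar configuration space is $\mathcal{C}_p:=[0,2\pi)\times\mathbb{R}_{\ge0}\times\mathbb{R}_{\ge0}$, with elements $(\phi,\rho,\theta)$. **Intersection angle intervals.** Fix $(\phi,\rho)\in[0,2\pi)\times[0,\overline{\rho}]$, the $l$-th ego circle with signed offset $L_e$, and the $q$-th object circle with signed offset $s$; put $L_o:=|s|$. With $x=\rho\cos\phi$, $y=\rho\sin\phi$, let $$\phi'=\mathrm{atan2}(y,x-L_e),\qquad \rho'=\sqrt{(x-L_e)^2+y^2}.$$ When $|R-L_o|\le\rho'\le R+L_o$ and $L_o\rho'>0$, let $$\overline{\theta},\underline{\theta}=\phi'+\pi\pm\arccos\left(\frac{L_o^2+\rho'^2-R^2}{2L_o\rho'}\right)$$ ($+$ for $\overline\theta$, $-$ for $\underline\theta$). For $s\ge0$, the interval $\mathbb{I}^{\theta_o}_{l,q}(\phi,\rho)$ is defined as follows. - If $\rho'>R+L_o$: $\emptyset$. - If $L_o>R$ and $\rho'\le R+L_o$: $[\underline\theta,\overline\theta]$ if $\rho'\ge L_o-R$, and $\emptyset$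 if $\rho'<L_o-R$. - If $R\ge L_o$ and $\rho'\le R+L_o$: $[\underline\theta,\overline\theta]$ if $\rho'>R-L_o$, and $[0,2\pi)$ if $\rho'\le R-L_o$. For $s<0$, $\mathbb{I}^{\theta_o}_{l,q}(\phi,\rho)$ is the interval given by these rules for offset $L_o=|s|$, translated by $\pi$. Angles are understood modulo $2\pi$: $\tilde{\mathcal{A}}_{\theta_o}(\phi,\rho)$ is the set of all $\theta\in\mathbb{R}_{\ge0}$ that are congruent modulo $2\pi$ to an element of $$\bigcup_{l=1}^{N_{c,e}}\bigcup_{q=1}^{N_{c,o}}\mathbb{I}^{\theta_o}_{l,q}(\phi,\rho).$$ Finally, $$\tilde{\mathcal{A}}_{cir}:=\{(\phi,\rho,\theta)\in\mathcal{C}_p\mid \phi\in[0,2\pi),\ \rho\in[0,\overline{\rho}],\ \theta\in\tilde{\mathcal{A}}_{\theta_o}(\phi,\rho)\}.$$ *)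

(* Defs.v *)
From HB Require Import structures.
From mathcomp Require Import all_boot all_order all_algebra.
From mathcomp Require Import all_classical all_reals all_analysis.
From mathcomp Require Import measurable_realfun.

Set Implicit Arguments.
Unset Strict Implicit.
Unset Printing Implicit Defensive.

Import Order.TTheory GRing.Theory Num.Theory.
Import numFieldNormedType.Exports.

Local Open Scope classical_set_scope.
Local Open Scope ring_scope.

(* A point of R * R * R is either a Cartesian configuration (x, y, theta) or a
   polar one (phi, rho, theta), with ((a, b), c) written (a, b, c). *)

Definition footprint (R : realType) (l w : R) (c : R * R * R) : set (R * R) :=
  [set p | exists u v : R, [/\ `|u| <= l / 2, `|v| <= w / 2 &
     p = (c.1.1 + u * cos c.2 - v * sin c.2,
          c.1.2 + u * sin c.2 + v * cos c.2)]].

Definition configurations (R : realType) : set (R * R * R) :=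
  [set c | 0 <= c.2].

Definition A_rec (R : realType) (le we lo wo : R) : set (R * R * R) :=
  [set c | configurations c /\
     footprint le we (0, 0, 0) `&` footprint lo wo c !=set0].

Definition circle_radius (R : realType) (l w : R) (N : nat) : R :=
  Num.sqrt ((l / (2 * N%:R)) ^+ 2 + w ^+ 2 / 4).

Definition circle_spacing (R : realType) (l w : R) (N : nat) : R :=
  2 * Num.sqrt (circle_radius l w N ^+ 2 - w ^+ 2 / 4).

(* Circles are numbered i = 1, ..., N. *)
Definition circle_offset (R : realType) (l w : R) (N i : nat) : R :=
  (i%:R - (N%:R + 1) / 2) * circle_spacing l w N.

Definition radius_sum (R : realType) (le we lo wo : R) (Ne No : nat) : R :=
  circle_radius le we Ne + circle_radius lo wo No.

Definition rho_bar (R : realType) (le we lo wo : R) (Ne No : nat) : R :=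
  radius_sum le we lo wo Ne No
  + circle_spacing lo wo No / 2 * (No%:R - 1)
  + circle_spacing le we Ne / 2 * (Ne%:R - 1).

(* Principal value in ]-pi, pi], with atan2 0 0 = 0. *)
Definition atan2 (R : realType) (y x : R) : R :=
  if 0 < x then atan (y / x)
  else if x < 0 then (if 0 <= y then atan (y / x) + pi else atan (y / x) - pi)
  else if 0 < y then pi / 2
  else if y < 0 then - (pi / 2)
  else 0.

(* The same angle taken in [0, 2 pi[. *)
Definition polar_angle (R : realType) (x y : R) : R :=
  if 0 <= atan2 y x then atan2 y x else atan2 y x + 2 * pi.

Definition to_polar (R : realType) (c : R * R * R) : R * R * R :=
  (polar_angle c.1.1 c.1.2, Num.sqrt (c.1.1 ^+ 2 + c.1.2 ^+ 2), c.2).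

(* Intersection angles for an object circle of offset Lo >= 0; (rho', phi') are
   the polar coordinates of the object's center seen from the ego circle's
   center.  Rs is the sum of the two radii.  The quotient has a nonzero
   denominator, and lies in [-1, 1], wherever [angle_interval_nneg] uses it. *)
Definition theta_halfwidth (R : realType) (Rs Lo rho' : R) : R :=
  acos ((Lo ^+ 2 + rho' ^+ 2 - Rs ^+ 2) / (2 * Lo * rho')).

Definition angle_interval_nneg (R : realType) (Rs Lo rho' phi' : R) : set R :=
  let arc := `[phi' + pi - theta_halfwidth Rs Lo rho',
               phi' + pi + theta_halfwidth Rs Lo rho']%classic in
  if Rs + Lo < rho' then set0
  else if Rs < Lo then (if Lo - Rs <= rho' then arc else set0)
  else (if Rs - Lo < rho' then arc else `[0, 2 * pi[%classic).

(* Le and s are the signed offsets of the ego circle and the object circle. *)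
Definition angle_interval (R : realType) (Rs Le s phi rho : R) : set R :=
  let x := rho * cos phi in
  let y := rho * sin phi in
  let phi' := atan2 y (x - Le) in
  let rho' := Num.sqrt ((x - Le) ^+ 2 + y ^+ 2) in
  let I := angle_interval_nneg Rs `|s| rho' phi' in
  if 0 <= s then I else [set t + pi | t in I].

Definition A_theta (R : realType) (le we lo wo : R) (Ne No : nat)
    (phi rho : R) : set R :=
  [set theta | 0 <= theta /\
     exists2 t,
       (\bigcup_(l in [set l : nat | (1 <= l <= Ne)%N])
          \bigcup_(q in [set q : nat | (1 <= q <= No)%N])
            angle_interval (radius_sum le we lo wo Ne No)
              (circle_offset le we Ne l) (circle_offset lo wo No q)
              phi rho) t
       & exists k : int, theta = t + k%:~R * (2 * pi)].

Definition polar_configurations (R : realType) : set (R * R * R) :=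
  [set c | [/\ 0 <= c.1.1 < 2 * pi, 0 <= c.1.2 & 0 <= c.2]].

Definition A_cir (R : realType) (le we lo wo : R) (Ne No : nat) :
    set (R * R * R) :=
  [set c | [/\ polar_configurations c,
     0 <= c.1.1 < 2 * pi,
     0 <= c.1.2 <= rho_bar le we lo wo Ne No &
     A_theta le we lo wo Ne No c.1.1 c.1.2 c.2]].

Definition has_density (R : realType) (d d' : measure_display)
    (Omega : measurableType d) (T : measurableType d')
    (P : probability Omega R) (mu : {measure set T -> \bar R})
    (X : Omega -> T) (p : T -> R) : Prop :=
  [/\ forall t, 0 <= p t,
      measurable_fun [set: T] p &
      forall A, measurable A ->
        P (X @^-1` A) = (\int[mu]_(t in A) (p t)%:E)%E].

(* The sets A, B, C may be the full space, so this includes the product rule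
   for every pair. *)
Definition mutually_independent3 (R : realType) (d : measure_display)
    (Omega : measurableType d) (P : probability Omega R)
    (X Y Z : Omega -> R) : Prop :=
  forall A B C : set R, measurable A -> measurable B -> measurable C ->
    P (X @^-1` A `&` Y @^-1` B `&` Z @^-1` C)
    = (P (X @^-1` A) * P (Y @^-1` B) * P (Z @^-1` C))%E.

Definition lebesgue3 (R : realType) :
    {measure set (measurableTypeR R * measurableTypeR R * measurableTypeR R)
       -> \bar R} :=
  ((@lebesgue_measure R \x @lebesgue_measure R) \x @lebesgue_measure R)%E.

Definition polar_density (R : realType) (px py : R -> R) (phi rho : R) : R :=
  rho * px (rho * cos phi) * py (rho * sin phi).

(* Main.v *)
(* Two footprints that meet have covering circles that meet, because each disk
   covers its slice of the rectangle and two disks with a common point have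
   centers at distance at most R.  The set A_cir, pulled back to Cartesian
   coordinates, is exactly the set of configurations for which some pair of
   circles meets: seen from an ego circle, the center of an object circle of
   offset s is at squared distance rho'^2 + 2 s rho' cos (theta - phi') + s^2,
   and solving "at most R^2" for theta gives the arcs of the definition.
   The integral formula is then Tonelli's theorem together with polar
   coordinates.  These are obtained for a half-plane from the two
   one-dimensional substitutions y = x tan phi and x = rho cos phi, and for
   the plane by rotating it onto the half-planes above and below the axis. *)
Require Import Defs.
From HB Require Import structures.
From mathcomp Require Import all_boot all_order all_algebra.
From mathcomp Require Import all_classical all_reals all_analysis.
From mathcomp Require Import measurable_realfun.
From mathcomp Require Import ring lra.

Set Implicit Arguments.
Unset Strict Implicit.
Unset Printing Implicit Defensive.

Import Order.TTheory GRing.Theory Num.Theory.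
Import numFieldNormedType.Exports.

Local Open Scope classical_set_scope.
Local Open Scope ring_scope.

(** * Covering circles *)

Lemma unit_cover (R : realType) (N : nat) (t : R) :
  (1 <= N)%N -> 0 <= t <= N%:R ->
  exists2 i : nat, (1 <= i <= N)%N & i%:R - 1 <= t <= i%:R.
Proof.
elim: N => // -[_ _ t01|N IH _ /andP[t0 tN]].
  by exists 1%N => //; rewrite subrr.
have [tN'|tN'] := lerP t N.+1%:R.
  have [|i /andP[i0 iN] it] := IH isT; first by rewrite t0.
  by exists i; rewrite // i0 (leq_trans iN).
exists N.+2; first by rewrite leqnn.
by rewrite tN andbT -[N.+2%:R]natr1 addrK ltW.
Qed.

(** The segment of length [L] is cut into [N] pieces of length [L / N]; a point is within half a
    piece of the midpoint of its piece. This serves both the circle centers and the rounding of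
    points to grids. *)
Lemma segment_cover (R : realType) (N : nat) (L u : R) :
  (1 <= N)%N -> 0 < L -> `|u| <= L / 2 ->
  exists2 i : nat, (1 <= i <= N)%N &
    `|u - (i%:R - (N%:R + 1) / 2) * (L / N%:R)| <= L / (2 * N%:R).
Proof.
move=> N1 L0; rewrite ler_norml => /andP[uL Lu].
have N0 : 0 < N%:R :> R by rewrite ltr0n.
pose d := L / N%:R; have d0 : 0 < d by rewrite divr_gt0.
have LE : L = N%:R * d by rewrite /d mulrCA divff ?mulr1// gt_eqF.
have -> : L / (2 * N%:R) = d / 2.
  by rewrite invfM mulrCA mulrC.
(* The position is measured from the left end, in units of one piece. *)
have [|i iN /andP[i1 i2]] := @unit_cover R N ((u + L / 2) / d) N1.
  apply/andP; split; first by apply: divr_ge0; [lra|exact: ltW].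
  by rewrite ler_pdivrMr// -LE; lra.
exists i => //; rewrite -/d.
move: i1 i2; rewrite ler_pdivlMr// ler_pdivrMr// => i1 i2.
rewrite ler_norml; apply/andP; split; nra.
Qed.

Lemma circle_radiusE (R : realType) (l w : R) (N : nat) :
  circle_radius l w N ^+ 2 = (l / (2 * N%:R)) ^+ 2 + w ^+ 2 / 4.
Proof. by rewrite sqr_sqrtr// addr_ge0 ?divr_ge0 ?sqr_ge0. Qed.

Lemma circle_spacingE (R : realType) (l w : R) (N : nat) :
  0 < l -> circle_spacing l w N = l / N%:R.
Proof.
move=> l0; rewrite /circle_spacing circle_radiusE addrK sqrtr_sqr.
rewrite ger0_norm ?divr_ge0 ?mulr_ge0 ?(ltW l0)//.
by rewrite invfM mulrCA mulVKf// pnatr_eq0.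
Qed.

(** The radius is half the diagonal of a slice of size [l / N] by [w], so the disk at the center of
    a slice contains the whole slice. *)
Lemma circle_cover (R : realType) (l w u v : R) (N : nat) :
  (1 <= N)%N -> 0 < l -> `|u| <= l / 2 -> `|v| <= w / 2 ->
  exists2 i : nat, (1 <= i <= N)%N &
    (u - circle_offset l w N i) ^+ 2 + v ^+ 2 <= circle_radius l w N ^+ 2.
Proof.
move=> N1 l0 ul vw.
have [i iN hi] := segment_cover N1 l0 ul.
exists i => //; rewrite /circle_offset circle_spacingE// circle_radiusE.
apply: lerD; rewrite -real_normK ?num_real//.
  by rewrite lerXn2r ?nnegrE ?(le_trans _ hi).
have -> : w ^+ 2 / 4 = (w / 2) ^+ 2 by field.
by rewrite lerXn2r ?nnegrE ?(le_trans _ vw).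
Qed.

(** The first and last circles are extremal; the bound is the summand that [rho_bar] reserves for
    each vehicle. *)
Lemma circle_offset_bound (R : realType) (l w : R) (N i : nat) :
  0 < l -> (1 <= i <= N)%N ->
  `|circle_offset l w N i| <= circle_spacing l w N / 2 * (N%:R - 1).
Proof.
move=> l0 /andP[i1 iN]; rewrite /circle_offset.
have d0 : 0 <= circle_spacing l w N.
  by rewrite circle_spacingE// divr_ge0 ?(ltW l0).
have i1' : 1 <= i%:R :> R by rewrite ler1n.
have iN' : i%:R <= N%:R :> R by rewrite ler_nat.
rewrite normrM (ger0_norm d0) -mulrA mulrC ler_wpM2l//.
by rewrite ler_norml; apply/andP; split; lra.
Qed.

(** The triangle inequality for Euclidean norms, kept in squared form; the cross term is
    Cauchy-Schwarz. *)
Lemma disk_add (R : realType) (a b c d r s : R) : 0 <= r -> 0 <= s ->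
  a ^+ 2 + b ^+ 2 <= r ^+ 2 -> c ^+ 2 + d ^+ 2 <= s ^+ 2 ->
  (a + c) ^+ 2 + (b + d) ^+ 2 <= (r + s) ^+ 2.
Proof.
move=> r0 s0 ab cd.
suff : a * c + b * d <= r * s by nra.
have [neg|pos] := lerP (a * c + b * d) 0.
  by rewrite (le_trans neg) ?mulr_ge0.
rewrite -(@ler_pXn2r _ 2)// ?nnegrE ?mulr_ge0 ?(ltW pos)//.
rewrite exprMn.
have : (a ^+ 2 + b ^+ 2) * (c ^+ 2 + d ^+ 2) <= r ^+ 2 * s ^+ 2.
  by apply: ler_pM => //; rewrite addr_ge0 ?sqr_ge0.
move=> rs. apply: le_trans rs; rewrite -subr_ge0.
(* Lagrange's identity: the Cauchy-Schwarz gap is a square. *)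
have -> : (a ^+ 2 + b ^+ 2) * (c ^+ 2 + d ^+ 2) - (a * c + b * d) ^+ 2 =
          (a * d - b * c) ^+ 2 by ring.
exact: sqr_ge0.
Qed.

(** * Angles *)

Section angles.
Context {R : realType}.
Implicit Types x y t q : R.

Lemma cosDpiE x : cos (x + pi) = - cos x. Proof. exact: cosDpi. Qed.
Lemma sinDpiE x : sin (x + pi) = - sin x. Proof. exact: sinDpi. Qed.

Lemma cosBpiE x : cos (x - pi) = - cos x.
Proof. by rewrite -[in RHS](subrK pi x) cosDpiE opprK. Qed.

Lemma sinBpiE x : sin (x - pi) = - sin x.
Proof. by rewrite -[in RHS](subrK pi x) sinDpiE opprK. Qed.

Lemma sin_atan x : sin (atan x) = x * cos (atan x).
Proof.
have c0 : cos (atan x) != 0.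
  by rewrite cos_atan invr_eq0 sqrtr_eq0 -ltNge ltr_pwDl ?sqr_ge0.
by rewrite -[X in _ = X * _]atanK /tan divfK.
Qed.

Lemma cos_atan_div x y : 0 < x ->
  Num.sqrt (x ^+ 2 + y ^+ 2) * cos (atan (y / x)) = x.
Proof.
move=> x0; have -> : x ^+ 2 + y ^+ 2 = x ^+ 2 * (1 + (y / x) ^+ 2).
  by field; rewrite gt_eqF.
rewrite sqrtrM ?sqr_ge0// sqrtr_sqr gtr0_norm// cos_atan mulfK//.
by rewrite sqrtr_eq0 -ltNge ltr_pwDl ?sqr_ge0.
Qed.

(** At the origin the radius vanishes, so the conventional value of [atan2 0 0] does no harm. *)
Lemma atan2_cos x y : Num.sqrt (x ^+ 2 + y ^+ 2) * cos (atan2 y x) = x.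
Proof.
rewrite /atan2; case: (ltrgtP x 0) => [x0|x0|->].
(* For [x < 0] the point [(- x, - y)] has the same quotient, and the shift by [pi] in either
   direction restores the sign. *)
- have := @cos_atan_div (- x) (- y); rewrite !sqrrN oppr_gt0 invrN mulrNN.
  move=> /(_ x0) h; case: ifP => _; rewrite ?cosDpiE ?cosBpiE mulrN h opprK//.
- exact: cos_atan_div.
- case: ltP => [y0|]; first by rewrite cos_pihalf mulr0.
  case: ltP => [y0 _|y0 y0']; first by rewrite cosN cos_pihalf mulr0.
  have -> : y = 0 by apply/eqP; rewrite eq_le y0 y0'.
  by rewrite expr0n/= addr0 sqrtr0 mul0r.
Qed.

Lemma atan2_sin x y : Num.sqrt (x ^+ 2 + y ^+ 2) * sin (atan2 y x) = y.
Proof.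
rewrite /atan2; case: (ltrgtP x 0) => [x0|x0|->].
- have := @cos_atan_div (- x) (- y); rewrite !sqrrN oppr_gt0 invrN mulrNN.
  move=> /(_ x0) h; case: ifP => _;
    rewrite ?sinDpiE ?sinBpiE sin_atan mulrN mulrCA h.
    by rewrite mulrN opprK divfK// lt_eqF.
  by rewrite mulrN opprK divfK// lt_eqF.
- by rewrite sin_atan mulrCA cos_atan_div// divfK// gt_eqF.
- case: ltP => [y0|]; first by
    rewrite sin_pihalf mulr1 expr0n/= add0r sqrtr_sqr gtr0_norm.
  case: ltP => [y0 _|y0 y0'].
    rewrite sinN sin_pihalf mulrN1 expr0n/= add0r sqrtr_sqr ltr0_norm//.
    by rewrite opprK.
  have -> : y = 0 by apply/eqP; rewrite eq_le y0 y0'.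
  by rewrite sin0 mulr0.
Qed.

Lemma atan2_bound x y : - pi < atan2 y x <= pi.
Proof.
have p0 := @pi_gt0 R.
have z0 := atan_gtNpi2 (y / x); have z1 := atan_ltpi2 (y / x).
rewrite /atan2; case: (ltrgtP x 0) => [x0|x0|_]; last 2 first.
- by apply/andP; split; lra.
- by case: ifP => _; [|case: ifP => _]; apply/andP; split; lra.
case: (leP 0 y) => y0; apply/andP; split; try lra.
- have : atan (y / x) <= atan 0.
    by rewrite le_atan// mulr_ge0_le0// invr_le0 ltW.
  by rewrite atan0; lra.
- have : atan 0 < atan (y / x) by rewrite lt_atan// nmulr_rgt0// invr_lt0.
  by rewrite atan0; lra.
Qed.

Lemma polar_angle_bound x y : 0 <= polar_angle x y < 2 * pi.
Proof.
have /andP[a1 a2] := atan2_bound x y; have p0 := @pi_gt0 R.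
rewrite /polar_angle; case: ifP => [a0|/negbT]; last rewrite -ltNge => a0.
  by apply/andP; split; lra.
by apply/andP; split; lra.
Qed.

Lemma cosDn2pi x (k : nat) : cos (x + k%:R * (2 * pi)) = cos x.
Proof.
have -> : k%:R * (2 * pi) = (pi *+ 2) *+ k :> R.
  by rewrite -[RHS]mulr_natl -[pi *+ 2]mulr_natl.
by rewrite periodicn//; exact: cosD2pi.
Qed.

Lemma sinDn2pi x (k : nat) : sin (x + k%:R * (2 * pi)) = sin x.
Proof.
have -> : k%:R * (2 * pi) = (pi *+ 2) *+ k :> R.
  by rewrite -[RHS]mulr_natl -[pi *+ 2]mulr_natl.
by rewrite periodicn//; exact: sinD2pi.
Qed.

Lemma cosDz2pi x (k : int) : cos (x + k%:~R * (2 * pi)) = cos x.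
Proof.
case: k => k; first exact: cosDn2pi.
by rewrite NegzE mulrNz mulNr -[in RHS](subrK (k.+1%:R * (2 * pi)) x) cosDn2pi.
Qed.

Lemma sinDz2pi x (k : int) : sin (x + k%:~R * (2 * pi)) = sin x.
Proof.
case: k => k; first exact: sinDn2pi.
by rewrite NegzE mulrNz mulNr -[in RHS](subrK (k.+1%:R * (2 * pi)) x) sinDn2pi.
Qed.

Lemma polar_angle_cos x y : cos (polar_angle x y) = cos (atan2 y x).
Proof.
rewrite /polar_angle; case: ifP => // _.
by have := cosDz2pi (atan2 y x) 1; rewrite mul1r.
Qed.

Lemma polar_angle_sin x y : sin (polar_angle x y) = sin (atan2 y x).
Proof.
rewrite /polar_angle; case: ifP => // _.
by have := sinDz2pi (atan2 y x) 1; rewrite mul1r.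
Qed.

Lemma mod2pi (a x : R) : exists k : int, a <= x - k%:~R * (2 * pi) < a + 2 * pi.
Proof.
have p0 : 0 < 2 * pi :> R by rewrite mulr_gt0 ?pi_gt0.
(* The floor counts the full turns from [a] to [x]. *)
exists (Num.floor ((x - a) / (2 * pi))).
have /andP[] := floor_itv ((x - a) / (2 * pi)).
rewrite ler_pdivlMr// ltr_pdivrMr// intrD => h1 h2.
by apply/andP; split; lra.
Qed.

End angles.

(** * Intersection arcs as solution sets in the heading *)

Lemma cos_ge_arcP (R : realType) (q a : R) : -1 <= q <= 1 ->
  (exists k : int, `|a - k%:~R * (2 * pi)| <= acos q) <-> q <= cos a.
Proof.
move=> q1; have acos_pi : acos q \in `[0, pi].
  by rewrite in_itv/= acos_ge0// acos_lepi.
(* Cosine is even and decreasing on [[0, pi]], so within half a turn an upper bound on the absolute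
   angle is a lower bound on its cosine. *)
have key (k : int) : `|a - k%:~R * (2 * pi)| <= pi ->
    (`|a - k%:~R * (2 * pi)| <= acos q) = (q <= cos a).
  move=> bpi; have -> : cos a = cos `|a - k%:~R * (2 * pi)|.
    by rewrite cos_norm -mulNr -mulrNz cosDz2pi.
  rewrite -[in RHS](acosK (x := q))// !leNgt ltr_cos// in_itv/=.
  by rewrite normr_ge0.
split=> [[k bk]|qa]; first by rewrite -(key k)// (le_trans bk)// acos_lepi.
(* The window starting at [- pi] selects a representative to which [key] applies. *)
have [k /andP[k1 k2]] := mod2pi (- pi) a; exists k.
by rewrite key// ler_norml; apply/andP; split; lra.
Qed.

Lemma mod_full_circle (R : realType) (a : R) :
  exists2 t, `[0, 2 * pi[%classic t & exists k : int, a = t + k%:~R * (2 * pi).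
Proof.
have [k /andP[k1 k2]] := mod2pi 0 a.
exists (a - k%:~R * (2 * pi)); last by exists k; rewrite subrK.
by rewrite /= in_itv/= k1; rewrite add0r in k2.
Qed.

(** By the law of cosines the inequality puts the object circle's center within [Rs] of the ego
    circle's center. As the heading varies, the former runs on a circle of radius [Lo], which lies
    outside the disk of radius [Rs], surrounds it, lies inside it, or meets its boundary; these are
    the cases of the definition. *)
Lemma angle_interval_nnegP (R : realType) (Rs Lo rho phi th : R) :
  0 <= Rs -> 0 <= Lo -> 0 <= rho ->
  (exists2 t, angle_interval_nneg Rs Lo rho phi t &
     exists k : int, th = t + k%:~R * (2 * pi)) <->
  Lo ^+ 2 + rho ^+ 2 + 2 * (Lo * rho) * cos (th - phi) <= Rs ^+ 2.
Proof.
move=> Rs0 Lo0 rho0; set c := cos (th - phi).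
have cN : -1 <= c by exact: cos_geN1.
have c1 : c <= 1 by exact: cos_le1.
have Lrho : 0 <= Lo * rho by exact: mulr_ge0.
(* The three bounds are the triangle inequalities for sides [Lo], [rho], [Rs]; they place the
   argument of [acos] in [[-1, 1]]. *)
have arcP : 0 < Lo -> 0 < rho ->
    Lo - Rs <= rho -> Rs - Lo <= rho -> rho <= Rs + Lo ->
    (exists2 t, `[phi + pi - theta_halfwidth Rs Lo rho,
                  phi + pi + theta_halfwidth Rs Lo rho]%classic t &
     exists k : int, th = t + k%:~R * (2 * pi)) <->
    Lo ^+ 2 + rho ^+ 2 + 2 * (Lo * rho) * c <= Rs ^+ 2.
  move=> L0 r0 h1 h2 h3; rewrite /theta_halfwidth; set q := (X in acos X).
  have Lr0 : 0 < 2 * Lo * rho by rewrite !mulr_gt0.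
  have q1 : -1 <= q <= 1.
    by rewrite /q; apply/andP; split; rewrite ?ler_pdivlMr ?ler_pdivrMr//; nra.
  (* The shift by [pi] turns an upper bound on the cosine into a lower one, which is why the arc is
     centered at [phi + pi]. *)
  have -> : (Lo ^+ 2 + rho ^+ 2 + 2 * (Lo * rho) * c <= Rs ^+ 2) =
      (q <= cos (th - phi - pi)).
    rewrite cosBpiE -/c /q ler_pdivrMr//.
    by apply/idP/idP => ?; nra.
  rewrite -(cos_ge_arcP _ q1); split=> [[t tq [k ->]]|[k hk]].
    exists k; move: tq; rewrite /= in_itv/= => /andP[t1 t2].
    by rewrite ler_norml; apply/andP; split; lra.
  exists (th - k%:~R * (2 * pi)); last by exists k; rewrite subrK.
  move: hk; rewrite ler_norml => /andP[k1 k2].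
  by rewrite /= in_itv/=; apply/andP; split; lra.
rewrite /angle_interval_nneg; case: ltP => h1.
  by split=> [[]//|]; rewrite leNgt => /negP[]; nra.
case: ltP => h2.
  case: leP => h3; first by apply: arcP => //; lra.
  by split=> [[]//|]; rewrite leNgt => /negP[]; nra.
case: ltP => h3.
  (* With [Lo = 0] the bounds [Rs < rho] and [rho <= Rs] would clash. *)
  have [L0|L0] := leP Lo 0; first by exfalso; lra.
  by apply: arcP => //; lra.
split=> _; last exact: mod_full_circle.
(* Even the farthest position, at distance [Lo + rho], is within [Rs]. *)
have : (Lo + rho) ^+ 2 <= Rs ^+ 2 by rewrite lerXn2r ?nnegrE//; lra.
nra.
Qed.

(** A circle at negative offset [s] is one at offset [- s] on the vehicle turned by [pi], which
    accounts for the translated interval. *)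
Lemma angle_intervalP (R : realType) (Rs L s phi rho th : R) : 0 <= Rs ->
  (exists2 t, angle_interval Rs L s phi rho t &
     exists k : int, th = t + k%:~R * (2 * pi)) <->
  (rho * cos phi + s * cos th - L) ^+ 2 + (rho * sin phi + s * sin th) ^+ 2
    <= Rs ^+ 2.
Proof.
move=> Rs0; rewrite /angle_interval.
set X := rho * cos phi - L; set Y := rho * sin phi.
set r := Num.sqrt _; set f := atan2 _ _.
have r0 : 0 <= r by exact: sqrtr_ge0.
have rE : r ^+ 2 = X ^+ 2 + Y ^+ 2 by rewrite sqr_sqrtr// addr_ge0 ?sqr_ge0.
have XE : X = r * cos f by rewrite /r /f atan2_cos.
have YE : Y = r * sin f by rewrite /r /f atan2_sin.
have -> : (rho * cos phi + s * cos th - L) ^+ 2 + (Y + s * sin th) ^+ 2 =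
    s ^+ 2 + r ^+ 2 + 2 * (s * r) * cos (th - f).
  rewrite cosB; have -> : rho * cos phi + s * cos th - L = X + s * cos th.
    by rewrite /X; ring.
  have := cos2Dsin2 th; rewrite rE.
  have -> : 2 * (s * r) * (cos th * cos f + sin th * sin f) =
     2 * s * (cos th * X + sin th * Y) by rewrite XE YE; ring.
  move=> /(congr1 ( *%R (s ^+ 2))); rewrite mulr1 => <-; ring.
case: (leP 0 s) => s0.
  by rewrite ger0_norm//; exact: angle_interval_nnegP.
rewrite ltr0_norm//.
have := @angle_interval_nnegP _ Rs (- s) r f (th - pi) Rs0.
rewrite oppr_ge0 ltW// => /(_ isT r0).
have -> : (- s) ^+ 2 + r ^+ 2 + 2 * (- s * r) * cos (th - pi - f) =
    s ^+ 2 + r ^+ 2 + 2 * (s * r) * cos (th - f).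
  by rewrite [th - pi - f]addrAC cosBpiE; ring.
move=> <-; split=> [[_ [t It <-] [k thE]]|[t It [k thE]]].
  by exists t => //; exists k; rewrite thE; ring.
exists (t + pi); first by exists t.
by exists k; move/(congr1 (+%R^~ pi)) : thE; rewrite subrK => ->; ring.
Qed.

(** * The two collision sets in Cartesian coordinates *)

Lemma radius_sum_ge0 (R : realType) (le we lo wo : R) (Ne No : nat) :
  0 <= radius_sum le we lo wo Ne No.
Proof. by rewrite addr_ge0 ?sqrtr_ge0. Qed.

(** Disks enter only through their centers: two of them meet exactly when the centers are at most
    the sum of the radii apart. The sign of the heading is left to [configurations]. *)
Definition circles_meet (R : realType) (le we lo wo : R) (Ne No : nat) :
    set (R * R * R) :=
  [set c | exists2 lq : nat * nat, (1 <= lq.1 <= Ne)%N && (1 <= lq.2 <= No)%N &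
    (c.1.1 + circle_offset lo wo No lq.2 * cos c.2
       - circle_offset le we Ne lq.1) ^+ 2
    + (c.1.2 + circle_offset lo wo No lq.2 * sin c.2) ^+ 2
    <= radius_sum le we lo wo Ne No ^+ 2].

Lemma A_thetaP (R : realType) (le we lo wo : R) (Ne No : nat) (phi rho th : R) :
  A_theta le we lo wo Ne No phi rho th <->
  0 <= th /\ circles_meet le we lo wo Ne No (rho * cos phi, rho * sin phi, th).
Proof.
have Rs0 := radius_sum_ge0 le we lo wo Ne No.
split=> -[th0].
  move=> [t [l lN [q qN It]] tE]; split => //.
  exists (l, q); first exact/andP.
  by apply/(angle_intervalP _ _ _ _ _ Rs0); exists t.
move=> [[l q] /andP[lN qN]] /(angle_intervalP _ _ _ _ _ Rs0) [t It tE].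
by split => //; exists t => //; exists l => //; exists q.
Qed.

(** The path from the origin to the ego circle's center, on to the object circle's center and then
    to the object's center has length at most [|L| + Rs + |s|]. Hence the cutoff at [rho_bar] in
    [A_cir] excludes no meeting circles. *)
Lemma circles_meet_rho_bar (R : realType) (le we lo wo : R) (Ne No : nat)
    (x y th : R) : 0 < le -> 0 < lo ->
  circles_meet le we lo wo Ne No (x, y, th) ->
  Num.sqrt (x ^+ 2 + y ^+ 2) <= rho_bar le we lo wo Ne No.
Proof.
move=> le0 lo0 [[l q] /andP[/= lN qN]]; set s := circle_offset lo _ _ _.
set L := circle_offset le _ _ _; set Rs := radius_sum _ _ _ _ _ _ => hR.
have hs := circle_offset_bound wo lo0 qN.
have hL := circle_offset_bound we le0 lN.
have Rs0 : 0 <= Rs by exact: radius_sum_ge0.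
have h1 : (x + s * cos th) ^+ 2 + (y + s * sin th) ^+ 2 <= (Rs + `|L|) ^+ 2.
  have -> : x + s * cos th = (x + s * cos th - L) + L by ring.
  rewrite -[y + _]addr0; apply: disk_add => //.
  by rewrite expr0n/= addr0 real_normK ?num_real.
have h2 : x ^+ 2 + y ^+ 2 <= (Rs + `|L| + `|s|) ^+ 2.
  have h := @disk_add _ _ _ (- (s * cos th)) (- (s * sin th)) _ `|s|
    (addr_ge0 Rs0 (normr_ge0 L)) (normr_ge0 s) h1.
  rewrite !addrK in h; apply: h.
  rewrite !sqrrN (exprMn _ s) (exprMn _ s (sin _)) -mulrDr cos2Dsin2 mulr1.
  by rewrite real_normK ?num_real.
apply: (@le_trans _ _ (Rs + `|L| + `|s|)); last by rewrite /rho_bar -/Rs; lra.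
rewrite -(@ler_pXn2r _ 2)// ?nnegrE ?sqrtr_ge0 ?addr_ge0 ?sqrtr_ge0//.
by rewrite sqr_sqrtr// addr_ge0 ?sqr_ge0.
Qed.

(** [polar_angle] and [atan2] differ by at most one full turn, so sine and cosine recover [x] and
    [y]; the range conditions of [A_cir] hold automatically when circles meet. *)
Lemma to_polar_A_cir (R : realType) (le we lo wo : R) (Ne No : nat) :
  0 < le -> 0 < lo ->
  @to_polar R @^-1` A_cir le we lo wo Ne No =
  @configurations R `&` circles_meet le we lo wo Ne No.
Proof.
move=> le0 lo0; apply/seteqP; split=> -[[x y] th] /=.
  move=> [_ _ _ /A_thetaP /=[th0]].
  by rewrite polar_angle_cos polar_angle_sin atan2_cos atan2_sin.
move=> [th0 m]; split => //=.
- by split => //=; exact: polar_angle_bound.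
- exact: polar_angle_bound.
- by rewrite sqrtr_ge0 (circles_meet_rho_bar le0 lo0 m).
apply/A_thetaP; split => //.
by rewrite polar_angle_cos polar_angle_sin atan2_cos atan2_sin.
Qed.

Lemma A_recP (R : realType) (le we lo wo x y th : R) :
  A_rec le we lo wo (x, y, th) <->
  0 <= th /\ exists u v, [/\ `|u| <= lo / 2, `|v| <= wo / 2,
    `|x + u * cos th - v * sin th| <= le / 2 &
    `|y + u * sin th + v * cos th| <= we / 2].
Proof.
split=> -[th0].
  move=> [p [[u' [v' [hu' hv' ->]]] [u [v [hu hv]]]]] /=.
  rewrite cos0 sin0 !mulr0 !mulr1 !add0r subr0 => -[e1 e2].
  by split => //; exists u, v; rewrite -e1 -e2.
move=> [u [v [hu hv h1 h2]]]; split => //.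
exists (x + u * cos th - v * sin th, y + u * sin th + v * cos th); split => /=.
  exists (x + u * cos th - v * sin th), (y + u * sin th + v * cos th).
  by split => //=; rewrite cos0 sin0 !mulr0 !mulr1 !add0r subr0.
by exists u, v.
Qed.

Lemma A_rec_circles_meet (R : realType) (le we lo wo : R) (Ne No : nat) :
  0 < le -> 0 < lo -> (1 <= Ne)%N -> (1 <= No)%N ->
  A_rec le we lo wo `<=` @configurations R `&` circles_meet le we lo wo Ne No.
Proof.
move=> le0 lo0 Ne1 No1 [[x y] th] /A_recP[th0 [u [v [hu hv hU hV]]]].
split => //; set U := x + _ - _ in hU; set V := y + _ + _ in hV.
have [q qN hq] := circle_cover No1 lo0 hu hv.
have [l lN hl] := circle_cover Ne1 le0 hU hV.
exists (l, q); first exact/andP.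
rewrite /= /radius_sum; set s := circle_offset lo _ _ _ in hq *.
(* The vector between the two circle centers is split at the common point [(U, V)] of the
   rectangles. *)
have -> : x + s * cos th - circle_offset le we Ne l =
    (U - circle_offset le we Ne l) + ((s - u) * cos th + v * sin th).
  by rewrite /U; ring.
have -> : y + s * sin th = V + ((s - u) * sin th - v * cos th).
  by rewrite /V; ring.
apply: disk_add; rewrite ?sqrtr_ge0//.
(* The second part is [(s - u, - v)] rotated by [th], and rotation keeps lengths. *)
apply: le_trans hq; rewrite le_eqVlt; apply/orP; left; apply/eqP.
have := cos2Dsin2 th.
move=> /(congr1 ( *%R ((u - s) ^+ 2 + v ^+ 2))); rewrite mulr1 => <-; ring.
Qed.

(** * Substitution in Lebesgue integrals *)

Section substitution.
Local Open Scope ereal_scope.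
Context {R : realType}.
Notation mu := (@lebesgue_measure R).
Import HBNNSimple.

Variables (D : set R) (F w : R -> R).
Hypotheses (mD : measurable D) (mF : measurable_fun D F).
Hypotheses (mw : measurable_fun D w) (w0 : forall x, D x -> (0 <= w x)%R).
Hypothesis wF : forall a b, (a < b)%R ->
  \int[mu]_(x in D `&` F @^-1` `]a, b]%classic) (w x)%:E = (b - a)%:E.

(** The measure with density [w] on [D], pushed forward by [F]; [wF] says that it gives half-open
    intervals their length. *)
Let wmeas (A : set (measurableTypeR R)) : \bar R :=
  \int[mu]_(x in D `&` F @^-1` A) (w x)%:E.

Let wmeas0 : wmeas set0 = 0.
Proof. by rewrite /wmeas preimage_set0 setI0 integral_set0. Qed.

Let wmeas_ge0 A : 0 <= wmeas A.
Proof. by apply: integral_ge0 => x [Dx _]; rewrite lee_fin w0. Qed.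

Let wmeas_sigma_additive : semi_sigma_additive wmeas.
Proof.
move=> A mA tA mUA.
have mDA k : measurable (D `&` F @^-1` A k) by apply: (mF mD); exact: mA.
have -> : wmeas (\bigcup_k A k) = \sum_(k <oo) wmeas (A k).
  rewrite /wmeas preimage_bigcup setI_bigcupr ge0_integral_bigcup//.
  - apply/measurable_EFinP; apply: measurable_funS mw => //.
    by move=> x [k _ []].
  - by move=> x [k _ [Dx _]]; rewrite lee_fin w0.
  - apply/trivIsetP => i j _ _ ij.
    move/trivIsetP : tA => /(_ i j Logic.I Logic.I ij) AA.
    by rewrite setIACA setIid -preimage_setI AA preimage_set0 setI0.
by apply: is_cvg_nneseries => n _ _; exact: wmeas_ge0.
Qed.

HB.instance Definition _ := isMeasure.Build _ _ _ wmeas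
  wmeas0 wmeas_ge0 wmeas_sigma_additive.

(** Half-open intervals determine Lebesgue measure. *)
Let wmeasE A : measurable A -> mu A = wmeas A.
Proof.
apply: lebesgue_measure_unique => _ [[a b]] _ <-.
have [ab|ba] := ltP a b.
  by rewrite /= lebesgue_measure_itv/= lte_fin ab [RHS]wF.
by rewrite set_itv_ge ?measure0 ?bnd_simp -?leNgt //= ?ltW// measure0.
Qed.

(** Both sides split over the finitely many values of [h]; on each level set the claim is
    [wmeasE]. *)
Let integral_sfun (h : {nnsfun R >-> R}) :
  \int[mu]_y (h y)%:E = \int[mu]_(x in D) ((h (F x))%:E * (w x)%:E).
Proof.
have mh r : measurable (h @^-1` [set r] : set (measurableTypeR R)).
  exact: (measurable_sfunP h).
have mDh r : measurable (D `&` F @^-1` (h @^-1` [set r])).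
  by apply: (mF mD); exact: measurable_sfunP.
have mind r : measurable_fun D
    (fun x => (\1_(h @^-1` [set r]) (F x))%:E * (w x)%:E).
  apply: emeasurable_funM; apply/measurable_EFinP => //.
  by apply: measurableT_comp => //; exact: measurable_indic.
transitivity (\sum_(r \in range h) r%:E * mu (h @^-1` [set r])).
  under eq_integral do rewrite fimfunE -fsumEFin//.
  rewrite ge0_integral_fsum//; last 2 first.
  - by move=> r; exact/measurable_EFinP/measurable_funM.
  - by move=> r x _; rewrite nnfun_muleindic_ge0.
  apply: eq_fsbigr => r; rewrite inE => -[t _ <-].
  under eq_integral do rewrite EFinM.
  rewrite ge0_integralZl_EFin//; last exact/measurable_EFinP.
  by rewrite integral_indic// setIT.
transitivity (\int[mu]_(x in D)
    (\sum_(r \in range h)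
      (r%:E * ((\1_(h @^-1` [set r]) (F x))%:E * (w x)%:E)))).
  rewrite ge0_integral_fsum//; last 2 first.
  - by move=> r; apply: measurable_funeM; exact: mind.
  - move=> r x Dx; rewrite muleA mule_ge0 ?lee_fin ?w0//.
    exact: nnfun_muleindic_ge0.
  apply: eq_fsbigr => r; rewrite inE => -[t _ <-].
  rewrite ge0_integralZl_EFin//; last 2 first.
  - by move=> x Dx; rewrite mule_ge0 ?lee_fin ?w0.
  - exact: mind.
  congr (_ * _); rewrite wmeasE// /wmeas integral_mkcondr.
  by apply: eq_integral => x xD; rewrite epatch_indic muleC.
apply: eq_integral => x xD.
rewrite [in RHS]fimfunE -fsumEFin// ge0_mule_fsuml => [|r].
  by apply: eq_fsbigr => r _; rewrite muleA.
exact: nnfun_muleindic_ge0.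
Qed.

(** Increasing simple functions and monotone convergence reduce this to [integral_sfun]. *)
Lemma ge0_integral_substitution (k : R -> \bar R) :
  measurable_fun setT k -> (forall y, 0 <= k y) ->
  \int[mu]_y k y = \int[mu]_(x in D) (k (F x) * (w x)%:E).
Proof.
move=> mk k0; pose h := nnsfun_approx measurableT mk.
have hnd x m n : (m <= n)%N -> (h m x <= h n x)%R.
  move=> mn; have /lefP := @nd_nnsfun_approx _ _ _ _ measurableT _ mk _ _ mn.
  exact.
have hk y : (h n y)%:E @[n --> \oo] --> k y by exact: cvg_nnsfun_approx.
transitivity (limn (fun n => \int[mu]_y (h n y)%:E)).
  rewrite -monotone_convergence//.
  - by apply: eq_integral => y _; exact/esym/cvg_lim.
  - by move=> n; apply/measurable_EFinP; exact: (measurable_funP (h n)).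
  - by move=> n y _; rewrite lee_fin.
  - by move=> y _ m n mn; rewrite lee_fin hnd.
under eq_fun do rewrite integral_sfun.
rewrite -monotone_convergence//.
- apply: eq_integral => x _; apply/cvg_lim => //.
  by apply: cvgeZr => //; exact: hk.
- move=> n; apply: emeasurable_funM; apply/measurable_EFinP => //.
  by apply: measurableT_comp => //; exact: (measurable_funP (h n)).
- by move=> n x Dx; rewrite mule_ge0 ?lee_fin ?w0.
- move=> x Dx m n mn; rewrite lee_wpmul2r ?lee_fin ?w0//.
  exact: hnd.
Qed.

End substitution.

(** * Polar coordinates *)

Section elementary_substitutions.
Local Open Scope ereal_scope.
Context {R : realType}.
Notation mu := (@lebesgue_measure R).
Notation T := (measurableTypeR R).

Lemma measurable_inv : measurable_fun [set: R] (@GRing.inv R).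
Proof.
rewrite -(setvU [set 0%R]); apply/measurable_funU => //.
  exact: measurableC.
split; last exact: measurable_fun_set1.
apply: open_continuous_measurable_fun.
  by apply: closed_openC; exact: closed_eq.
by move=> x; rewrite inE/= => /eqP x0; exact: inv_continuous.
Qed.

Lemma measurable_sin : measurable_fun [set: R] (@sin R).
Proof. by apply: continuous_measurable_fun; exact: continuous_sin. Qed.

Lemma measurable_cos : measurable_fun [set: R] (@cos R).
Proof. by apply: continuous_measurable_fun; exact: continuous_cos. Qed.

Lemma measurable_tan : measurable_fun [set: R] (@tan R).
Proof.
apply: measurable_funM; first exact: measurable_sin.
by apply: (measurableT_comp measurable_inv); exact: measurable_cos.
Qed.

(** [f] may be negative off the rectangle; extension by zero allows Tonelli on the whole plane. *)
Lemma integral_rect_swap (X Y : set T) (f : T * T -> \bar R) :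
  measurable X -> measurable Y -> measurable_fun [set: T * T] f ->
  (forall x y, X x -> Y y -> 0 <= f (x, y)) ->
  \int[mu]_(x in X) \int[mu]_(y in Y) f (x, y) =
  \int[mu]_(y in Y) \int[mu]_(x in X) f (x, y).
Proof.
move=> mX mY mf f0; pose g := f \_ (X `*` Y).
have mXY : measurable (X `*` Y : set (T * T)) by exact: measurableX.
have mg : measurable_fun [set: T * T] g.
  apply: (measurable_restrictT f mXY).1.
  exact: (measurable_funS measurableT (@subsetT _ _) mf).
have g0 (z : T * T) : 0 <= g z.
  rewrite /g patchE; case: ifPn => //; rewrite inE => -[Xx Yy].
  by case: z Xx Yy => x y /= Xx Yy; exact: f0.
have E := @fubini_tonelli _ _ T T R mu mu g mg g0.
have gxy x y : g (x, y) =
    if x \in X then if y \in Y then f (x, y) else 0 else 0.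
  by rewrite /g patchE in_setX/=; case: (x \in X).
transitivity (\int[mu]_x \int[mu]_y g (x, y)).
  rewrite integral_mkcond; apply: eq_integral => x _.
  rewrite patchE; case: ifPn => xX.
    rewrite integral_mkcond; apply: eq_integral => y _.
    by rewrite gxy xX patchE.
  rewrite integral0_eq// => y _.
  by rewrite gxy (negbTE xX).
rewrite E [RHS]integral_mkcond; apply: eq_integral => y _.
rewrite patchE; case: ifPn => yY.
  rewrite [RHS]integral_mkcond; apply: eq_integral => x _.
  by rewrite gxy yY patchE.
rewrite integral0_eq// => x _.
by rewrite gxy (negbTE yY); case: ifP.
Qed.

Lemma ge0_integral_affine (c d : R) (k : R -> \bar R) : (c != 0)%R ->
  measurable_fun setT k -> (forall y, 0 <= k y) ->
  \int[mu]_y k y = \int[mu]_x (k (c * x + d)%R * `|c|%:E).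
Proof.
move=> c0 mk k0.
apply: (@ge0_integral_substitution _ setT (fun x => c * x + d)%R
          (cst `|c|%R)) => //.
  by apply: measurable_funD => //; exact: measurable_funM.
have mF : measurable_fun [set: R] (fun x => c * x + d)%R.
  by apply: measurable_funD => //; exact: measurable_funM.
move=> a b ab.
have mab : measurable
    (setT `&` (fun x => c * x + d)%R @^-1` `]a, b]%classic).
  by apply: mF.
have /= -> := @integral_cst _ T R mu _ mab `|c|%:E; rewrite setTI.
have c'0 : (0 < `|c|)%R by rewrite normr_gt0.
suff -> : mu ((fun x : R => c * x + d)%R @^-1` `]a, b]) = ((b - a) / `|c|)%:E.
  by rewrite -EFinM mulrC divfK// gt_eqF.
have [cn|cp|/esym/eqP] := ltrgtP c 0; last by rewrite eq_sym (negbTE c0).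
(* For [c < 0] the endpoints trade places, so the preimage is closed on the left and open on the
   right. *)
- have -> : (fun x : R => c * x + d)%R @^-1` `]a, b] =
      `[((b - d) / c)%R, ((a - d) / c)%R[%classic.
    apply/seteqP; split=> x /=;
      rewrite !in_itv/= ler_ndivrMr// ltr_ndivlMr// mulrC.
      by move=> /andP[? ?]; apply/andP; split; lra.
    by move=> /andP[? ?]; apply/andP; split; lra.
  rewrite lebesgue_measure_itv/= lte_fin ltr_nM2r ?invr_lt0// ltrD2r ab.
  by rewrite -EFinD ltr0_norm//; congr EFin; field.
- have -> : (fun x : R => c * x + d)%R @^-1` `]a, b] =
      `]((a - d) / c)%R, ((b - d) / c)%R]%classic.
    apply/seteqP; split=> x /=;
      rewrite !in_itv/= ler_pdivlMr// ltr_pdivrMr// mulrC.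
      by move=> /andP[? ?]; apply/andP; split; lra.
    by move=> /andP[? ?]; apply/andP; split; lra.
  rewrite lebesgue_measure_itv/= lte_fin ltr_pM2r ?invr_gt0// ltrD2r ab.
  by rewrite -EFinD gtr0_norm//; congr EFin; field.
Qed.

(** The weight is the derivative of [x * tan phi]. Each []a, b]] pulls back to an interval between
    two values of [atan], which stays away from the poles of [tan], so the fundamental theorem of
    calculus gives its weighted length. *)
Lemma ge0_integral_tan (x : R) (k : R -> \bar R) : (0 < x)%R ->
  measurable_fun setT k -> (forall y, 0 <= k y) ->
  \int[mu]_y k y = \int[mu]_(phi in `](- (pi / 2))%R, (pi / 2)%R[)
                     (k (x * tan phi)%R * (x * cos phi ^- 2)%:E).
Proof.
move=> x0 mk k0.
have mw : measurable_fun [set: R] (fun phi => x * cos phi ^- 2)%R.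
  apply: measurable_funM => //; apply: (measurableT_comp measurable_inv).
  by apply: measurable_funX; exact: measurable_cos.
have mF : measurable_fun [set: R] (fun phi => x * tan phi)%R.
  by apply: measurable_funM => //; exact: measurable_tan.
have cos_gt0 (phi : R) :
    phi \in `](- (pi / 2))%R, (pi / 2)%R[ -> (0 < cos phi)%R.
  by rewrite in_itv/=; exact: cos_gt0_pihalf.
apply: (@ge0_integral_substitution _ _ (fun phi => x * tan phi)%R
          (fun phi => x * cos phi ^- 2)%R) => //.
- exact: measurable_funTS.
- exact: measurable_funTS.
- move=> phi /cos_gt0 c0.
  by rewrite mulr_ge0 ?(ltW x0)// invr_ge0 exprn_ge0 ?ltW.
move=> a b ab.
have atan_in (y : R) : atan y \in `](- (pi / 2))%R, (pi / 2)%R[.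
  by rewrite in_itv/= atan_gtNpi2 atan_ltpi2.
have -> : `](- (pi / 2))%R, (pi / 2)%R[%classic `&`
      (fun phi => x * tan phi)%R @^-1` `]a, b]
    = `](atan (a / x))%R, (atan (b / x))%R]%classic.
  apply/seteqP; split=> phi /=.
    move=> [hphi]; rewrite !in_itv/= => /andP[h1 h2].
    rewrite -(tanK hphi) lt_atan ?le_atan//.
      by rewrite ler_pdivlMr// mulrC.
    by rewrite ltr_pdivrMr// mulrC.
  rewrite in_itv/= => /andP[h1 h2].
  have hphi : phi \in `](- (pi / 2))%R, (pi / 2)%R[.
    rewrite in_itv/= (lt_trans _ h1) ?atan_gtNpi2//.
    by rewrite (le_lt_trans h2)// atan_ltpi2.
  split => //; rewrite in_itv/=; apply/andP; split.
    by rewrite mulrC -ltr_pdivrMr// -[X in (X < _)%R]atanK ltr_tan.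
  rewrite mulrC -ler_pdivlMr// -[X in (_ <= X)%R]atanK leNgt ltr_tan//.
  by rewrite -leNgt.
rewrite integral_itv_obnd_cbnd; last exact/measurable_EFinP/measurable_funTS.
have sub (phi : R) :
    phi \in `[(atan (a / x))%R, (atan (b / x))%R] -> (0 < cos phi)%R.
  rewrite in_itv/= => /andP[h1 h2]; apply: cos_gt0.
  rewrite in_itv/= (lt_le_trans _ h1) ?atan_gtNpi2//.
  by rewrite (le_lt_trans h2)// atan_ltpi2.
have dF (phi : R) : (0 < cos phi)%R ->
    is_derive phi (1%R : R) (fun phi => x * tan phi)%R (x * cos phi ^- 2)%R.
  move=> c0; have dtan := is_derive_tan (lt0r_neq0 c0).
  exact: is_deriveZ.
have cF (y : R) : {for atan y, continuous (fun phi => x * tan phi)%R}.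
  apply: continuousM; first exact: cst_continuous.
  by apply: continuous_tan; rewrite gt_eqF// cos_gt0.
rewrite (@continuous_FTC2 _ _ (fun phi => x * tan phi)%R).
- by rewrite !atanK -EFinB; congr EFin; field; rewrite gt_eqF.
- by rewrite lt_atan// ltr_pM2r// invr_gt0.
- apply: continuous_in_subspaceT => phi; rewrite inE => /sub c0.
  apply: cvgM; first exact: cvg_cst.
  apply: cvgV; first by rewrite expf_neq0 ?gt_eqF.
  apply: (@continuous_comp _ _ _ (@cos R) (fun y => y ^+ 2)%R).
    exact: continuous_cos.
  exact: exprn_continuous.
- split.
  + move=> phi hphi; have /dF[] // : (0 < cos phi)%R.
    by apply: sub; exact: subset_itv_oo_cc hphi.
  + exact/cvg_at_right_filter/cF.
  + exact/cvg_at_left_filter/cF.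
- move=> phi hphi; rewrite derive1E.
  apply: (@derive_val _ _ _ _ _ _ _ (dF _ _)).
  by apply: sub; exact: subset_itv_oo_cc hphi.
Qed.

End elementary_substitutions.

(** * Polar coordinates in the right half-plane *)

Section polar_coordinates.
Local Open Scope ereal_scope.
Context {R : realType}.
Notation mu := (@lebesgue_measure R).
Notation T := (measurableTypeR R).

Lemma measurable_polar_map :
  measurable_fun [set: T * T]
    (fun z => (z.2 * cos z.1, z.2 * sin z.1)%R : T * T).
Proof.
apply: measurable_fun_pair; apply: measurable_funM => //.
  exact: (measurableT_comp measurable_cos).
exact: (measurableT_comp measurable_sin).
Qed.

(** The Jacobian [rho] is part of the integrand. The origin is left out to match [x > 0] under
    [x = rho cos phi]. *)
Definition polar_ray (h : T * T -> \bar R) (phi : T) : \bar R :=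
  \int[mu]_(rho in `]0%R, +oo[)
    (rho%:E * h ((rho * cos phi)%R, (rho * sin phi)%R)).

Variable h : T * T -> \bar R.
Hypotheses (mh : measurable_fun [set: T * T] h) (h0 : forall z, 0 <= h z).

Lemma polar_ray_ge0 phi : 0 <= polar_ray h phi.
Proof.
apply: integral_ge0 => rho; rewrite /= in_itv/= andbT => r0.
by rewrite mule_ge0// lee_fin ltW.
Qed.

(** Cut off to [rho > 0], the integrand is nonnegative, and measurability in [phi] is part of
    Tonelli's theorem. *)
Lemma measurable_polar_ray : measurable_fun [set: T] (polar_ray h).
Proof.
pose f (z : T * T) := z.2%:E * h ((z.2 * cos z.1)%R, (z.2 * sin z.1)%R).
have mf : measurable_fun [set: T * T] f.
  apply: emeasurable_funM; first exact/measurable_EFinP.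
  exact: (measurableT_comp mh measurable_polar_map).
have mpos : measurable ([set: T] `*` `]0%R, +oo[%classic : set (T * T)).
  exact: measurableX.
pose g := f \_ ([set: T] `*` `]0%R, +oo[%classic).
have mg : measurable_fun [set: T * T] g.
  apply: (measurable_restrictT f mpos).1.
  exact: (measurable_funS measurableT (@subsetT _ _) mf).
have g0 z : 0 <= g z.
  rewrite /g patchE; case: ifPn => //; rewrite inE/= in_itv/= andbT => -[_ r0].
  by rewrite mule_ge0// lee_fin ltW.
have := @measurable_fun_fubini_tonelli_F _ _ T T R mu g mg g0.
congr (measurable_fun _ _); apply/funext => phi.
rewrite /polar_ray [RHS]integral_mkcond; apply: eq_integral => rho _.
by rewrite /g !patchE in_setX in_setT.
Qed.

(* The line integral over [y] is parametrized by [y = x tan phi]; after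
   exchanging the integrals, [x = rho cos phi]. *)
Lemma integral_right_half_plane :
  \int[mu]_(x in `]0%R, +oo[) \int[mu]_y h (x, y) =
  \int[mu]_(phi in `](- (pi / 2))%R, (pi / 2)%R[) polar_ray h phi.
Proof.
pose f (z : T * T) : \bar R :=
  h (z.1, (z.1 * tan z.2)%R) * (z.1 * cos z.2 ^- 2)%:E.
have mtan : measurable_fun [set: T * T] (fun z => z.1 * tan z.2 : R)%R.
  apply: measurable_funM => //.
  exact: (measurableT_comp measurable_tan).
have mf : measurable_fun [set: T * T] f.
  apply: emeasurable_funM.
    by apply: (measurableT_comp mh); exact: measurable_fun_pair.
  apply/measurable_EFinP; apply: measurable_funM => //.
  apply: (measurableT_comp measurable_inv).
  by apply: measurable_funX; exact: (measurableT_comp measurable_cos).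
have f_ge0 (x phi : T) : (0 < x)%R -> (0 < cos phi)%R -> 0 <= f (x, phi).
  move=> x0 c0; rewrite /f mule_ge0// lee_fin/= mulr_ge0 ?ltW//.
  by rewrite invr_gt0 exprn_gt0.
transitivity (\int[mu]_(x in `]0%R, +oo[)
    \int[mu]_(phi in `](- (pi / 2))%R, (pi / 2)%R[) f (x, phi)).
  apply: eq_integral => x; rewrite inE/= in_itv/= andbT => x0.
  rewrite (ge0_integral_tan x0)//.
  exact: measurable_fun_pair2.
have mX : measurable (`]0%R, +oo[%classic : set T) by exact: measurable_itv.
have mY : measurable (`](- (pi / 2))%R, (pi / 2)%R[%classic : set T).
  exact: measurable_itv.
rewrite (integral_rect_swap mX mY mf); last first.
  move=> x phi; rewrite /= !in_itv/= andbT => x0 hphi.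
  by apply: f_ge0 => //; exact: cos_gt0_pihalf.
apply: eq_integral => phi; rewrite inE/= in_itv/= => /cos_gt0_pihalf c0.
(* Extension by zero replaces the half-line by the line; as [c > 0], scaling by [c] preserves
   positivity. *)
set c := cos phi in c0; pose k := (fun x => f (x, phi)) \_ `]0%R, +oo[.
have mk : measurable_fun [set: R] k.
  apply: (@measurable_restrictT _ _ R _ `]0%R, +oo[
            (fun x => f (x, phi)) _).1 => //.
  by apply: measurable_funTS; exact: measurable_fun_pair1.
have k0 x : 0 <= k x.
  rewrite /k patchE; case: ifPn => //; rewrite inE/= in_itv/= andbT => x0.
  exact: f_ge0.
rewrite integral_mkcond (@ge0_integral_affine _ c 0%R k) ?gt_eqF//.
rewrite /polar_ray [RHS]integral_mkcond; apply: eq_integral => rho _.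
rewrite /k !patchE !mem_setE !in_itv/= !andbT addr0 pmulr_rgt0//.
case: ifPn => r0; last by rewrite mul0e.
(* The two Jacobians combine: with [x = c * rho], the product of [x / c ^+ 2] and [c] is [rho]. *)
rewrite /f /= -/c -muleA -EFinM muleC gtr0_norm//; congr (_%:E * h (_, _)).
- by field; rewrite gt_eqF.
- exact: mulrC.
- by rewrite /tan -/c; field; rewrite gt_eqF.
Qed.

End polar_coordinates.

(** * Polar coordinates in the whole plane *)

Section polar_integral.
Local Open Scope ereal_scope.
Context {R : realType}.
Notation mu := (@lebesgue_measure R).
Notation T := (measurableTypeR R).

Let measurable_funT (D : set T) (k : T -> \bar R) :
  measurable_fun [set: T] k -> measurable_fun D k.
Proof. exact: measurable_funTS. Qed.

Lemma ge0_integral_oppr (k : T -> \bar R) :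
  measurable_fun [set: T] k -> (forall y, 0 <= k y) ->
  \int[mu]_y k y = \int[mu]_y k (- y)%R.
Proof.
move=> mk k0; rewrite (@ge0_integral_affine _ (-1)%R 0%R k) ?oppr_eq0//.
by apply: eq_integral => y _; rewrite mulN1r addr0 normrN1 mule1.
Qed.

Lemma ge0_integral_itv_shift (a b d : R) (k : T -> \bar R) :
  measurable_fun [set: T] k -> (forall y, 0 <= k y) ->
  \int[mu]_(x in `]a, b[) k (x + d)%R =
  \int[mu]_(x in `](a + d)%R, (b + d)%R[) k x.
Proof.
move=> mk k0; rewrite [LHS]integral_mkcond [RHS]integral_mkcond.
have mI : measurable (`](a + d)%R, (b + d)%R[%classic : set T).
  exact: measurable_itv.
rewrite (@ge0_integral_affine _ 1%R d (k \_ `](a + d)%R, (b + d)%R[))//.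
- apply: eq_integral => x _.
  by rewrite !patchE normr1 mule1 mul1r !mem_setE !in_itv/= !ltrD2r.
- apply: (measurable_restrictT k mI).1.
  exact: (measurable_funS measurableT (@subsetT _ _) mk).
- by move=> y; rewrite patchE; case: ifP.
Qed.

Variable h : T * T -> \bar R.
Hypotheses (mh : measurable_fun [set: T * T] h) (h0 : forall z, 0 <= h z).

(* Rotating the plane by [alpha] turns the right half-plane into any other. *)
Let integral_rotated_half_plane (g : T * T -> \bar R) (alpha : R) :
  measurable_fun [set: T * T] g -> (forall z, 0 <= g z) ->
  (forall rho psi : R, g ((rho * cos psi)%R, (rho * sin psi)%R) =
     h ((rho * cos (psi + alpha))%R, (rho * sin (psi + alpha))%R)) ->
  \int[mu]_(p in `]0%R, +oo[) \int[mu]_q g (p, q) =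
  \int[mu]_(phi in `](- (pi / 2) + alpha)%R, (pi / 2 + alpha)%R[)
    polar_ray h phi.
Proof.
move=> mg g0 gh; rewrite (integral_right_half_plane mg g0).
rewrite -ge0_integral_itv_shift; last 2 first.
- exact: measurable_polar_ray.
- exact: polar_ray_ge0.
apply: eq_integral => psi _; apply: eq_integral => rho _.
by rewrite gh.
Qed.

(** A quarter turn sends [(p, q)] to [(- q, p)], so [p] becomes [y]; the sign of [x] disappears in
    the integral over the whole line. *)
Let integral_upper_half_plane :
  \int[mu]_(y in `]0%R, +oo[) \int[mu]_x h (x, y) =
  \int[mu]_(phi in `]0%R, pi[) polar_ray h phi.
Proof.
have mg : measurable_fun [set: T * T] (fun z => h ((- z.2)%R, z.1)).
  apply: (measurableT_comp mh); apply: measurable_fun_pair => //.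
  exact: measurableT_comp.
have := @integral_rotated_half_plane _ (pi / 2) mg.
rewrite addNr -splitr => <- => [|//|rho psi].
  apply: eq_integral => y _; rewrite ge0_integral_oppr//.
  exact: measurable_fun_pair1.
by rewrite cosDpihalf sinDpihalf mulrN.
Qed.

(** Three quarters of a turn send [(p, q)] to [(q, - p)], so [p] becomes [- y]. *)
Let integral_lower_half_plane :
  \int[mu]_(y in `]-oo, 0%R]) \int[mu]_x h (x, y) =
  \int[mu]_(phi in `]pi, (2 * pi)%R[) polar_ray h phi.
Proof.
have mg : measurable_fun [set: T * T] (fun z => h (z.2, (- z.1)%R)).
  apply: (measurableT_comp mh); apply: measurable_fun_pair => //.
  exact: measurableT_comp.
have := @integral_rotated_half_plane _ (pi + pi / 2) mg.
have -> : (- (pi / 2) + (pi + pi / 2) = pi :> R)%R by lra.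
have -> : (pi / 2 + (pi + pi / 2) = 2 * pi :> R)%R by lra.
move=> <- => [|//|rho psi]; last first.
  by rewrite addrA cosDpihalf sinDpihalf cosDpiE sinDpiE opprK mulrN.
have mG : measurable_fun [set: T] (fun y => \int[mu]_x h (x, (- y)%R)).
  exact: (@measurable_fun_fubini_tonelli_F _ _ T T R mu _ mg).
have G0 (y : T) : 0 <= \int[mu]_x h (x, (- y)%R) by exact: integral_ge0.
(* The null point 0 is added so that reflection yields []-oo, 0]], which contains it. *)
rewrite integral_itv_obnd_cbnd; last exact: measurable_funT.
have -> := @ge0_integration_by_substitution0 _ _ mG G0.
by apply: eq_integral => y _; rewrite opprK.
Qed.

(** The plane is split along the horizontal axis, which goes to the lower half; the angles at the
    ends of the two arcs form a null set. *)
Lemma integral_polar :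
  \int[mu]_x \int[mu]_y h (x, y) =
  \int[mu]_(phi in `[0%R, (2 * pi)%R]) polar_ray h phi.
Proof.
have pi0 := @pi_gt0 R; have mray := measurable_polar_ray mh h0.
have ray0 := polar_ray_ge0 h0.
have mG : measurable_fun [set: T] (fun y => \int[mu]_x h (x, y)).
  exact: (@measurable_fun_fubini_tonelli_G _ _ T T R mu h mh h0).
rewrite (@fubini_tonelli _ _ T T R mu mu h mh h0).
have mN : measurable (`]-oo, 0%R]%classic : set T) by exact: measurable_itv.
have mP : measurable (`]0%R, +oo[%classic : set T) by exact: measurable_itv.
have ETU : [set: T] = `]-oo, 0%R]%classic `|` `]0%R, +oo[%classic.
  apply/seteqP; split=> y //= _; rewrite !in_itv/= andbT.
  by case: leP => _; [left|right].
have mGU := @measurable_funT (`]-oo, 0%R] `|` `]0%R, +oo[) _ mG.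
have dU : [disjoint `]-oo, 0%R]%classic & `]0%R, +oo[%classic : set T].
  apply/disj_setPS => y [] /=; rewrite !in_itv/= andbT => y0 /lt_geF.
  by rewrite y0.
have G0 (y : T) : 0 <= \int[mu]_x h (x, y).
  by apply: integral_ge0 => x _; exact: h0.
transitivity (\int[mu]_(y in `]-oo, 0%R] `|` `]0%R, +oo[) \int[mu]_x h (x, y)).
  by rewrite -ETU.
transitivity (\int[mu]_(y in `]-oo, 0%R]) \int[mu]_x h (x, y) +
              \int[mu]_(y in `]0%R, +oo[) \int[mu]_x h (x, y)).
  exact: (@ge0_integral_setU _ _ _ mu _ _ mN mP _ mGU (fun y _ => G0 y) dU).
rewrite integral_upper_half_plane integral_lower_half_plane addeC.
have m1 : measurable (`[0%R, pi]%classic : set T) by exact: measurable_itv.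
have m2 : measurable (`]pi, (2 * pi)%R]%classic : set T).
  exact: measurable_itv.
have EI : `[0%R, (2 * pi)%R]%classic =
    `[0%R, pi]%classic `|` `]pi, (2 * pi)%R]%classic
    :> set T.
  apply/seteqP; split=> y /=; rewrite !in_itv/=.
    move=> /andP[y0 y2]; case: (leP y pi) => yp; [left|right] => //.
    by rewrite y0.
  by move=> [] /andP[y1 y2]; apply/andP; split; lra.
have mrayU := @measurable_funT (`[0%R, pi] `|` `]pi, (2 * pi)%R]) _ mray.
have dI : [disjoint `[0%R, pi]%classic & `]pi, (2 * pi)%R]%classic : set T].
  apply/disj_setPS => y [] /=; rewrite !in_itv/= => /andP[_ y1] /andP[y2 _].
  by move: y2; rewrite ltNge y1.
rewrite EI; apply/esym.
transitivity (\int[mu]_(phi in `[0%R, pi]) polar_ray h phi +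
              \int[mu]_(phi in `]pi, (2 * pi)%R]) polar_ray h phi).
  exact: (@ge0_integral_setU _ _ _ mu _ _ m1 m2 _ mrayU (fun y _ => ray0 y) dI).
have mray' (a b : R) := @measurable_funT `]a, b[ _ mray.
by rewrite !(integral_itv_bndoo _ _ (mray' _ _)).
Qed.

End polar_integral.

(** * Measurability of the collision sets *)

Section measurability.
Context {R : realType}.
Notation T := (measurableTypeR R).
Notation T3 := (measurableTypeR R * measurableTypeR R * measurableTypeR R)%type.

Let mx : measurable_fun [set: T3] (fun c => c.1.1 : R).
Proof. exact: (measurableT_comp measurable_fst measurable_fst). Qed.

Let my : measurable_fun [set: T3] (fun c => c.1.2 : R).
Proof. exact: (measurableT_comp measurable_snd measurable_fst). Qed.

Let mth : measurable_fun [set: T3] (fun c => c.2 : R).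
Proof. exact: measurable_snd. Qed.

Let mcos : measurable_fun [set: T3] (fun c => cos c.2 : R).
Proof. exact: (measurableT_comp measurable_cos mth). Qed.

Let msin : measurable_fun [set: T3] (fun c => sin c.2 : R).
Proof. exact: (measurableT_comp measurable_sin mth). Qed.

Let measurable_sublevel (f : T3 -> R) (r : R) :
  measurable_fun [set: T3] f -> measurable [set c | f c <= r].
Proof.
move=> mf; rewrite -[X in measurable X]setTI.
have -> : [set c | f c <= r] = f @^-1` `]-oo, r]%classic.
  by apply/seteqP; split=> c /=; rewrite in_itv.
by apply: mf => //; exact: measurable_itv.
Qed.

Lemma measurable_configurations : measurable (@configurations R : set T3).
Proof.
have -> : @configurations R = [set c | - c.2 <= 0].
  by apply/seteqP; split=> c /=; rewrite oppr_le0.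
by apply: measurable_sublevel; exact: measurableT_comp mth.
Qed.

Lemma measurable_circles_meet (le we lo wo : R) (Ne No : nat) :
  measurable (circles_meet le we lo wo Ne No : set T3).
Proof.
pose F (l q : nat) (c : T3) : R :=
  (c.1.1 + circle_offset lo wo No q * cos c.2 - circle_offset le we Ne l) ^+ 2
  + (c.1.2 + circle_offset lo wo No q * sin c.2) ^+ 2.
have -> : circles_meet le we lo wo Ne No =
  \bigcup_(l in [set l | (1 <= l <= Ne)%N])
  \bigcup_(q in [set q | (1 <= q <= No)%N])
    [set c | F l q c <= radius_sum le we lo wo Ne No ^+ 2].
  apply/seteqP; split=> c.
    by move=> [[l q] /andP[lN qN] h]; exists l => //; exists q.
  by move=> [l lN [q qN h]]; exists (l, q) => //; exact/andP.
apply: bigcup_measurable => l _; apply: bigcup_measurable => q _.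
apply: measurable_sublevel; apply: measurable_funD; apply: measurable_funX.
  apply: measurable_funB => //; apply: measurable_funD => //.
  exact: measurable_funM.
apply: measurable_funD => //; exact: measurable_funM.
Qed.

Lemma ler_grid_eps (g e : R) : 0 < e ->
  (forall N, (1 <= N)%N -> g <= e / (2 * N%:R)) -> g <= 0.
Proof.
move=> e0 h; rewrite leNgt; apply/negP => g0.
(* Large enough that [e / N] is below [g]. *)
pose N := (Num.truncn (e / g)).+1.
have N0 : 0 < N%:R :> R by rewrite ltr0n.
have := h N isT; rewrite leNgt => /negP; apply.
rewrite ltr_pdivrMr ?mulr_gt0// mulrCA -ltr_pdivrMl//.
have : e / g < N%:R by exact: truncnS_gt.
rewrite ltr_pdivrMr// mulrC => h1.
by rewrite mulrC; have := mulr_gt0 g0 N0; lra.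
Qed.

Lemma grid_point_bound (L : R) (N i : nat) : 0 < L -> (1 <= i <= N)%N ->
  `|(i%:R - (N%:R + 1) / 2) * (L / N%:R)| <= L / 2.
Proof.
move=> L0 /andP[i1 iN].
have N0 : 0 < N%:R :> R by rewrite ltr0n (leq_trans i1).
have d0 : 0 < L / N%:R by rewrite divr_gt0.
rewrite normrM (gtr0_norm d0).
have -> : L / 2 = N%:R / 2 * (L / N%:R) by field; rewrite gt_eqF.
rewrite ler_pM2r//.
have i1' : 1 <= i%:R :> R by rewrite ler1n.
have iN' : i%:R <= N%:R :> R by rewrite ler_nat.
by rewrite ler_norml; apply/andP; split; lra.
Qed.

Let gridpt (L : R) (N i : nat) : R := (i%:R - (N%:R + 1) / 2) * (L / N%:R).

Let near_box (le we e u v : R) : set T3 :=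
  [set c | `|c.1.1 + u * cos c.2 - v * sin c.2| <= le / 2 + e] `&`
  [set c | `|c.1.2 + u * sin c.2 + v * cos c.2| <= we / 2 + e].

(* Rounding [(u, v)] to a grid point moves the object's point by at most the
   mesh, and conversely compactness of the object's rectangle turns arbitrarily
   good approximations into a common point. *)
Let A_rec_grid (le we lo wo : R) : 0 < lo -> 0 < wo ->
  A_rec le we lo wo = @configurations R `&`
    \bigcap_(N in [set N | (1 <= N)%N])
    \bigcup_(i in [set i | (1 <= i <= N)%N])
    \bigcup_(j in [set j | (1 <= j <= N)%N])
      near_box le we ((lo + wo) / (2 * N%:R)) (gridpt lo N i) (gridpt wo N j).
Proof.
move=> lo0 wo0; apply/seteqP; split=> -[[x y] th].
  move=> /A_recP[th0 [u [v [hu hv h1 h2]]]]; split => // N /= N1.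
  have [i iN hi] := segment_cover N1 lo0 hu.
  have [j jN hj] := segment_cover N1 wo0 hv.
  exists i => //; exists j => //; rewrite -/(gridpt _ _ _) in hi hj.
  have c1 := cos_max th; have s1 := sin_max th.
  have prod (a b e : R) : `|a| <= e -> `|b| <= 1 -> `|a * b| <= e.
    by move=> ae b1; rewrite normrM (le_trans _ ae)// ler_piMr.
  (* The tolerance splits into the rounding errors [lo / (2 * N)] in [u] and [wo / (2 * N)] in
     [v]. *)
  rewrite mulrDl; split => /=.
    have -> : x + gridpt lo N i * cos th - gridpt wo N j * sin th =
      (x + u * cos th - v * sin th) +
      (- ((u - gridpt lo N i) * cos th) + (v - gridpt wo N j) * sin th) by ring.
    apply: (le_trans (ler_normD _ _)); apply: lerD => //.
    apply: (le_trans (ler_normD _ _)); rewrite normrN.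
    by apply: lerD; exact: prod.
  have -> : y + gridpt lo N i * sin th + gridpt wo N j * cos th =
    (y + u * sin th + v * cos th) +
    (- ((u - gridpt lo N i) * sin th) - (v - gridpt wo N j) * cos th) by ring.
  apply: (le_trans (ler_normD _ _)); apply: lerD => //.
  apply: (le_trans (ler_normD _ _)); rewrite !normrN.
  by apply: lerD; exact: prod.
move=> [th0 grid]; apply/A_recP; split => //.
(* [g p <= 0] will say that the object's point with body coordinates [p] lies in the ego's
   rectangle; [g] attains its minimum on the compact [K]. *)
pose a (p : R * R) := `|x + p.1 * cos th - p.2 * sin th| - le / 2.
pose b (p : R * R) := `|y + p.1 * sin th + p.2 * cos th| - we / 2.
pose g (p : R * R) := Num.max (a p) (b p).
pose K := `[- (lo / 2), lo / 2]%classic `*` `[- (wo / 2), wo / 2]%classic.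
have K0 : K !=set0.
  by exists (0, 0); split; rewrite /= in_itv/=; apply/andP; split; lra.
have cK : compact K by apply: compact_setX; exact: segment_compact.
have c1 (p : R * R) : q.1 @[q --> p] --> p.1.
  by case: p => ? ?; exact: cvg_fst.
have c2 (p : R * R) : q.2 @[q --> p] --> p.2.
  by case: p => ? ?; exact: cvg_snd.
have ca : continuous a.
  move=> p; rewrite /continuous_at /a.
  apply: cvgB; last exact: cvg_cst.
  apply: cvg_norm; apply: cvgB; last by apply: cvgM; [exact: c2|exact: cvg_cst].
  by apply: cvgD; [exact: cvg_cst|apply: cvgM; [exact: c1|exact: cvg_cst]].
have cb : continuous b.
  move=> p; rewrite /continuous_at /b.
  apply: cvgB; last exact: cvg_cst.
  apply: cvg_norm; apply: cvgD; last by apply: cvgM; [exact: c2|exact: cvg_cst].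
  by apply: cvgD; [exact: cvg_cst|apply: cvgM; [exact: c1|exact: cvg_cst]].
have cg : continuous g.
  by move=> p; apply: continuous_max; [exact: ca|exact: cb].
have [p pK gp] := compact_EVT_min K0 cK (continuous_subspaceT cg).
(* The minimum lies below the tolerance of every grid, hence is at most zero. *)
have : g p <= 0.
  apply: (@ler_grid_eps _ (lo + wo)); first exact: addr_gt0.
  move=> N N1; have [i iN [j jN [h1 h2]]] := grid N N1.
  have qK : (gridpt lo N i, gridpt wo N j) \in K.
    rewrite inE; split; rewrite /= in_itv/= -ler_norml; exact: grid_point_bound.
  apply: (le_trans (gp _ qK)); rewrite /g ge_max /a /b !lerBlDl.
  by apply/andP; split.
rewrite /g ge_max /a /b !subr_le0 => /andP[h1 h2].
move: pK; rewrite inE => -[/=]; rewrite !in_itv/= -!ler_norml => hu hv.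
by exists p.1, p.2.
Qed.

(** The definition quantifies over uncountably many points; the grid form uses only countably many
    sublevel sets of measurable functions. *)
Lemma measurable_A_rec (le we lo wo : R) : 0 < lo -> 0 < wo ->
  measurable (A_rec le we lo wo : set T3).
Proof.
move=> lo0 wo0; rewrite A_rec_grid//; apply: measurableI.
  exact: measurable_configurations.
apply: bigcap_measurable; first by exists 1%N.
move=> N _; apply: bigcup_measurable => i _; apply: bigcup_measurable => j _.
apply: measurableI; apply: measurable_sublevel; apply: measurableT_comp => //.
  apply: measurable_funB; last exact: measurable_funM.
  by apply: measurable_funD => //; exact: measurable_funM.
apply: measurable_funD; last exact: measurable_funM.
by apply: measurable_funD => //; exact: measurable_funM.
Qed.

End measurability.

(** * Integrals of product densities *)

Section density.
Local Open Scope ereal_scope.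
Context {R : realType}.
Notation mu := (@lebesgue_measure R).
Notation T := (measurableTypeR R).
Variables (B : set (T * T * T)) (px py pt : T -> R).
Hypotheses (mB : measurable B) (mpx : measurable_fun [set: T] px)
  (mpy : measurable_fun [set: T] py) (mpt : measurable_fun [set: T] pt).
Hypotheses (px0 : forall x, (0 <= px x)%R) (py0 : forall x, (0 <= py x)%R)
  (pt0 : forall x, (0 <= pt x)%R).

(** The heading is integrated out first, over the slice of [B] above [z], which leaves a planar
    integrand for polar coordinates. *)
Let h (z : T * T) : \bar R :=
  (px z.1 * py z.2)%:E * \int[mu]_(t in [set t | B (z, t)]) (pt t)%:E.

Let h_ge0 z : 0 <= h z.
Proof.
rewrite mule_ge0 ?lee_fin ?mulr_ge0//.
by apply: integral_ge0 => t _; rewrite lee_fin.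
Qed.

Let p (c : T * T * T) : \bar R := (px c.1.1 * py c.1.2 * pt c.2)%:E.

Let mpB : measurable_fun [set: T * T * T] (p \_ B).
Proof.
have mp : measurable_fun [set: T * T * T] p.
  apply/measurable_EFinP; apply: measurable_funM.
    apply: measurable_funM.
      apply: (measurableT_comp mpx).
      exact: (measurableT_comp measurable_fst measurable_fst).
    apply: (measurableT_comp mpy).
    exact: (measurableT_comp measurable_snd measurable_fst).
  exact: (measurableT_comp mpt measurable_snd).
apply: (measurable_restrictT p mB).1.
exact: (measurable_funS measurableT (@subsetT _ _) mp).
Qed.

Let pB_ge0 c : 0 <= (p \_ B) c.
Proof.
by rewrite patchE; case: ifP => // _; rewrite lee_fin !mulr_ge0.
Qed.

Let hE z : \int[mu]_t (p \_ B) (z, t) = h z.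
Proof.
have mBz : measurable [set t : T | B (z, t)].
  have -> : [set t : T | B (z, t)] = xsection B z.
    by apply/seteqP; split=> t; rewrite /xsection/= inE.
  exact: measurable_xsection.
rewrite /h -ge0_integralZl//; last 3 first.
- by apply/measurable_EFinP; exact: measurable_funTS.
- by move=> t _; rewrite lee_fin.
- by rewrite lee_fin mulr_ge0.
rewrite [RHS]integral_mkcond; apply: eq_integral => t _.
rewrite !patchE; have -> : ((z, t) \in B) = (t \in [set t | B (z, t)]).
  by apply/idP/idP => /set_mem Bzt; exact/mem_set.
by case: ifP.
Qed.

Let mh : measurable_fun [set: T * T] h.
Proof.
have := @measurable_fun_fubini_tonelli_F _ _ (T * T)%type T R mu _ mpB pB_ge0.
by congr (measurable_fun _ _); apply/funext => z; exact: hE.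
Qed.

(* For the product of two measures, type inference only finds the
   sub-probability instance of the library. *)
Let plane_sigma_finite :
  sigma_finite [set: T * T] (@lebesgue_measure R \x @lebesgue_measure R).
Proof.
pose I n : set T := `[(- n%:R)%R, n%:R%R]%classic.
have mI n : measurable (I n) by exact: measurable_itv.
exists (fun n => I n `*` I n).
  apply/seteqP; split=> // -[x y] _.
  pose n := (Num.truncn (`|x| + `|y|)%R).+1.
  have xyn : (`|x| + `|y| < n%:R)%R by exact: truncnS_gt.
  exists n => //; split; rewrite /I/= in_itv/= -ler_norml ltW//.
    by apply: le_lt_trans xyn; rewrite lerDl.
  by apply: le_lt_trans xyn; rewrite lerDr.
move=> n; split; first exact: measurableX.
rewrite product_measure1E//; apply: lte_mul_pinfty => //.
  by rewrite /= lebesgue_measure_itv/=; case: ifP.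
by rewrite /= lebesgue_measure_itv/=; case: ifP => //; rewrite -EFinB ltry.
Qed.

Let plane_measure : {sigma_finite_measure set (T * T)%type -> \bar R} :=
  HB.pack (@lebesgue_measure R \x @lebesgue_measure R)
    (Measure_isSigmaFinite.Build _ _ _
      (@lebesgue_measure R \x @lebesgue_measure R) plane_sigma_finite).

Let integral_density_polar_ray :
  \int[@lebesgue3 R]_(c in B) p c =
  \int[mu]_(phi in `[0%R, (2 * pi)%R]) polar_ray h phi.
Proof.
transitivity (\int[@lebesgue_measure R \x @lebesgue_measure R]_z h z).
  rewrite integral_mkcond.
  transitivity (\int[@lebesgue_measure R \x @lebesgue_measure R]_z
      \int[@lebesgue_measure R]_t (p \_ B) (z, t)).
    exact: (@fubini_tonelli1 _ _ _ _ R plane_measure _ (p \_ B) mpB pB_ge0).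
  by apply: eq_integral => z _; exact: hE.
rewrite -(integral_polar mh h_ge0).
exact: (fubini_tonelli1 h mh h_ge0).
Qed.

(** Beyond [b] the slices of [B] are empty, so the integral along each ray stops at [b]. *)
Lemma integral_density_polar (b : R) :
  (forall rho phi t, (b < rho)%R ->
    ~ B ((rho * cos phi)%R, (rho * sin phi)%R, t)) ->
  \int[@lebesgue3 R]_(c in B) (px c.1.1 * py c.1.2 * pt c.2)%:E =
  \int[mu]_(phi in `[0%R, (2 * pi)%R]) \int[mu]_(rho in `[0%R, b])
    ((polar_density px py phi rho)%:E *
     \int[mu]_(t in [set t | B ((rho * cos phi)%R, (rho * sin phi)%R, t)])
       (pt t)%:E).
Proof.
move=> Bb; rewrite [LHS]integral_density_polar_ray; apply: eq_integral => phi _.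
set k := (X in _ = \int[mu]_(rho in _) X rho).
have kE (rho : R) : rho%:E * h ((rho * cos phi)%R, (rho * sin phi)%R) = k rho.
  by rewrite /h /k /polar_density muleA -EFinM !mulrA.
have mk : measurable_fun [set: T] k.
  have : measurable_fun [set: T]
      (fun rho : T => rho%:E * h ((rho * cos phi)%R, (rho * sin phi)%R)).
    apply: emeasurable_funM; first exact/measurable_EFinP.
    apply: (measurableT_comp mh).
    by apply: measurable_fun_pair; exact: measurable_funM.
  by congr (measurable_fun _ _); apply/funext => rho; exact: kE.
have mk' : measurable_fun (`]0%R, b]%classic : set T) k.
  exact: measurable_funTS.
(* The point [rho = 0] is null, so the right side may start just after it, as [polar_ray] does. *)
rewrite -(integral_itv_obnd_cbnd mk') /polar_ray.
rewrite [LHS]integral_mkcond [RHS]integral_mkcond.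
apply: eq_integral => rho _; rewrite !patchE !mem_setE !in_itv/= andbT.
case: (ltP 0%R rho) => //= r0; case: leP => // br.
rewrite kE /k.
rewrite [X in _ * X]integral0_eq ?mule0// => t Bt.
by case: (Bb _ _ _ br Bt).
Qed.

End density.

(** * Comparison of the two collision probabilities *)

Theorem theorem1 (R : realType) (d : measure_display)
    (Omega : measurableType d) (P : probability Omega R)
    (le we lo wo : R) (Nce Nco : nat)
    (hwe : 0 < we) (hle : we <= le) (hwo : 0 < wo) (hlo : wo <= lo)
    (hNce : (1 <= Nce)%N) (hNco : (1 <= Nco)%N)
    (x_o y_o theta_o : {RV P >-> R})
    (theta_o_ge0 : forall omega, 0 <= theta_o omega)
    (p_yo : R * R * R -> R) (p_x p_y p_theta : R -> R)
    (hp_yo : has_density P (@lebesgue3 R)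
       (fun omega => (x_o omega, y_o omega, theta_o omega)) p_yo)
    (hp_x : has_density P (@lebesgue_measure R) x_o p_x)
    (hp_y : has_density P (@lebesgue_measure R) y_o p_y)
    (hp_theta : has_density P (@lebesgue_measure R) theta_o p_theta)
    (hindep : mutually_independent3 P x_o y_o theta_o)
    (hprod : forall x y theta : R,
       p_yo (x, y, theta) = p_x x * p_y y * p_theta theta) :
  let yo : Omega -> R * R * R :=
    fun omega => (x_o omega, y_o omega, theta_o omega) in
  let yop : Omega -> R * R * R := fun omega => to_polar (yo omega) in
  [/\ P (yo @^-1` A_rec le we lo wo)
        = (\int[@lebesgue3 R]_(c in A_rec le we lo wo) (p_yo c)%:E)%E,
      (P (yo @^-1` A_rec le we lo wo)
        <= P (yop @^-1` A_cir le we lo wo Nce Nco))%E &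
      P (yop @^-1` A_cir le we lo wo Nce Nco)
        = (\int[@lebesgue_measure R]_(phi in `[0%R, (2 * pi)%R]%classic)
            \int[@lebesgue_measure R]_(rho in
                 `[0%R, rho_bar le we lo wo Nce Nco]%classic)
              ((polar_density p_x p_y phi rho)%:E *
               \int[@lebesgue_measure R]_(theta in
                   A_theta le we lo wo Nce Nco phi rho)
                 (p_theta theta)%:E))%E].
Proof.
move=> yo yop.
have le0 : 0 < le by exact: lt_le_trans hle.
have lo0 : 0 < lo by exact: lt_le_trans hlo.
have myo : measurable_fun [set: Omega]
    (yo : Omega -> measurableTypeR R * measurableTypeR R * measurableTypeR R).
  apply: measurable_fun_pair; last exact: measurable_funP theta_o.
  apply: measurable_fun_pair; first exact: measurable_funP x_o.
  exact: measurable_funP y_o.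
have mrec := measurable_A_rec le we lo0 hwo.
(* [B] is the Cartesian form of [A_cir], so both events become preimages under [yo], whose density
   is given. *)
set B := @configurations R `&` circles_meet le we lo wo Nce Nco.
have mB : measurable
    (B : set (measurableTypeR R * measurableTypeR R * measurableTypeR R)).
  apply: measurableI; first exact: measurable_configurations.
  exact: measurable_circles_meet.
have [p0 mp Pyo] := hp_yo; have [px0 mpx _] := hp_x.
have [py0 mpy _] := hp_y; have [pt0 mpt _] := hp_theta.
have yopE : yop @^-1` A_cir le we lo wo Nce Nco = yo @^-1` B.
  by rewrite /B -(to_polar_A_cir we wo Nce Nco le0 lo0).
rewrite yopE; split.
- exact: Pyo.
- apply: le_measure; rewrite ?inE.
  + by rewrite -[X in measurable X]setTI; exact: (myo measurableT _ mrec).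
  + by rewrite -[X in measurable X]setTI; exact: (myo measurableT _ mB).
  + by move=> w; exact: A_rec_circles_meet.
rewrite Pyo//.
transitivity (\int[@lebesgue3 R]_(c in B)
    (p_x c.1.1 * p_y c.1.2 * p_theta c.2)%:E)%E.
  by apply: eq_integral => -[[x y] th] _; rewrite hprod.
rewrite (@integral_density_polar R B p_x p_y p_theta mB mpx mpy mpt px0 py0 pt0
          (rho_bar le we lo wo Nce Nco)).
  apply: eq_integral => phi _; apply: eq_integral => rho _.
  (* At the polar point [(phi, rho)] the heading slice of [B] is [A_theta]. *)
  congr (_ * _)%E; congr (integral _ _ _); apply/seteqP; split=> t.
    by move=> [t0 m]; apply/A_thetaP.
  by move=> /A_thetaP[t0 m].
(* [rho] may have any sign here; it is at most its absolute value, which is the distance to the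
   origin. *)
move=> rho phi t br [_ m]; move: br; rewrite ltNge => /negP; apply.
apply: le_trans (circles_meet_rho_bar le0 lo0 m).
rewrite !exprMn -mulrDr cos2Dsin2 mulr1 sqrtr_sqr; exact: ler_norm.
Qed.
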